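(* Let $f_1, f_2,\ldots, f_m:\mathbb{F}_{q^n}\rightarrow \mathbb{F}_q$ and $h_1, h_2, \ldots, h_m:\mathbb{F}_q\rightarrow \mathbb{F}_q$ be mappings, and let $A_1,\ldots,A_m$ be additive permutation polynomials over $\mathbb{F}_q$. Let $b_1, b_2, \ldots, b_m\in \mathbb{F}_q$, and let $\gamma_1, \gamma_2, \ldots, \gamma_m\in \mathbb{F}_{q^n}^*$ be linearly independent over $\mathbb{F}_q$. Suppose that for each $i\in\{1,\ldots,m\}$, $\gamma_i$ is a $(b_i,A_i)$-linear translator of $f_i$, and a $(0,A_j)$-linear translator of $f_j$ for every $j\neq i$. Then $$F(x)=x+\sum_{i=1}^{m}\gamma_ih_i(f_i(x))$$ is a permutation polynomial over $\mathbb{F}_{q^n}$ (i.e. $F$ permutes $\mathbb{F}_{q^n}$) if and only if for every $i\in\{1,\ldots,m\}$, $g_i(x)=x+b_iA_i(h_i(x))$ is a permutation polynomial over $\mathbb{F}_q$. Moreover, in that case the compositional inverse of $F(x)$ is given by $$F^{-1}(x)=x-\sum_{i=1}^{m}\gamma_ih_i(g_i^{-1}(f_i(x))).$$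
   Context: $q$ is a prime power and $n,m$ are positive integers. An additive permutation polynomial over $\mathbb{F}_q$ is a polynomial $A(x)\in\mathbb{F}_q[x]$ that is additive, $A(x+y)=A(x)+A(y)$, and induces a permutation of $\mathbb{F}_q$. Let $f:\mathbb{F}_{q^n}\to\mathbb{F}_q$ be a function, $A$ an additive permutation polynomial over $\mathbb{F}_q$, and $b\in\mathbb{F}_q$ fixed. A nonzero element $\gamma\in\mathbb{F}_{q^n}$ is called a $(b,A)$-linear translator of $f$ if $f(x+u\gamma)-f(x)=bA(u)$ for all $x\in\mathbb{F}_{q^n}$ and all $u\in\mathbb{F}_q$. The compositional inverse of a permutation is its inverse map. *)

(* Defs.v *)
From HB Require Import structures.
From mathcomp Require Import all_boot all_order all_algebra all_fingroup all_field.

Set Implicit Arguments.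
Unset Strict Implicit.
Unset Printing Implicit Defensive.

Import GRing.Theory.
Local Open Scope ring_scope.

(* Additivity is required of the induced map on F only, as is bijectivity;
   a formally additive (linearized) polynomial satisfies it in particular. *)
Definition additive_perm_poly (F : finFieldType) (A : {poly F}) : Prop :=
  (forall x y : F, A.[x + y] = A.[x] + A.[y]) /\ bijective (fun x : F => A.[x]).

Definition linear_translator (F : finFieldType) (L : fieldExtType F)
    (b : F) (A : {poly F}) (f : L -> F) (gamma : L) : Prop :=
  gamma != 0 /\
  forall (x : L) (u : F), f (x + u *: gamma) - f x = b * A.[u].

Definition inverse_map (T : Type) (phi psi : T -> T) : Prop :=
  cancel phi psi /\ cancel psi phi.

(* Main.v *)
Require Import Defs.
From HB Require Import structures.
From mathcomp Require Import all_boot all_order all_algebra all_fingroup all_field.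

Set Implicit Arguments.
Unset Strict Implicit.
Unset Printing Implicit Defensive.

Import GRing.Theory.
Local Open Scope ring_scope.

(** Moving [x] by a combination of the [gamma i] changes [f j x] only through
    the coefficient of [gamma j], and by an amount independent of [x].  Hence
    [f j] intertwines [Phi] with [g j]: [f j (Phi x) = g j (f j x)]
    ([translator_shift] at the coefficients [h i (f i x)]).

    If every [g i] is invertible, then [h i (f i x)] can be recovered from
    [Phi x] as [h i (ginv i (f i (Phi x)))], so the correction added by [Phi]
    can be subtracted again; this gives the stated inverse
    ([shift_map_inverse]).

    Conversely, let [Phi] be bijective.  If [b j = 0] then [g j] is the
    identity.  Otherwise [f j] is onto, because [u |-> b j * (A j).[u]] is; then
    [g j \o f j = f j \o Phi] is onto, so [g j] is onto, and a surjection of the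
    finite field [F] to itself is a bijection ([component_bijective]). *)

Lemma finType_surj_bij (T : finType) (phi : T -> T) :
  (forall y, exists x, phi x = y) -> bijective phi.
Proof.
move=> /fin_all_exists [r rK].
by apply: (bij_can_bij (injF_bij (can_inj rK))).
Qed.

Lemma additive_perm_polyN (F : finFieldType) (A : {poly F}) (u : F) :
  additive_perm_poly A -> A.[- u] = - A.[u].
Proof.
case=> AD _; have A0 : A.[0] = 0.
  by apply: (addrI A.[0]); rewrite -AD !addr0.
by apply: (addrI A.[u]); rewrite -AD !subrr.
Qed.

(** A nonzero translation constant makes [f] surjective already on a single
    line in the direction [gamma]. *)
Lemma translator_surj (F : finFieldType) (L : fieldExtType F) (b : F)
    (A : {poly F}) (f : L -> F) (gamma : L) :
  additive_perm_poly A -> linear_translator b A f gamma -> b != 0 ->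
  forall c, exists x, f x = c.
Proof.
move=> [_ [Ainv _ AK]] [_ fT] b0 c.
exists (0 + Ainv ((c - f 0) / b) *: gamma).
by apply: (addIr (- f 0)); rewrite fT AK mulrC divfK.
Qed.

Section SeveralTranslators.

Variables (F : finFieldType) (L : fieldExtType F) (m : nat).
Variables (f : 'I_m -> L -> F) (h : 'I_m -> F -> F) (A : 'I_m -> {poly F}).
Variables (b : 'I_m -> F) (gamma : 'I_m -> L).
Hypothesis A_perm : forall i, additive_perm_poly (A i).
Hypothesis translator_diag :
  forall i, linear_translator (b i) (A i) (f i) (gamma i).
Hypothesis translator_off :
  forall i j, j != i -> linear_translator 0 (A j) (f j) (gamma i).

Let Phi (x : L) := x + \sum_(i < m) h i (f i x) *: gamma i.
Let g (i : 'I_m) (x : F) := x + b i * (A i).[h i x].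

(** The translator conditions decouple the coordinates: [f j] is blind to the
    directions [gamma i] with [i != j], which can be peeled off one by one
    since each condition holds at every base point. *)
Lemma translator_shift (u : 'I_m -> F) (j : 'I_m) (x : L) :
  f j (x + \sum_(i < m) u i *: gamma i) = f j x + b j * (A j).[u j].
Proof.
have offE (s : L) : f j (s + \sum_(i < m | i != j) u i *: gamma i) = f j s.
  elim/big_rec: _ s => [|i t neq_ij IHt] s; first by rewrite addr0.
  have [_ fT] : linear_translator 0 (A j) (f j) (gamma i).
    by apply: translator_off; rewrite eq_sym.
  by rewrite addrA IHt; apply/eqP; rewrite -subr_eq0 fT mul0r.
rewrite (bigD1 j) //= addrA offE; have [_ fT] := translator_diag j.
by rewrite -(fT x) subrKC.
Qed.

Lemma shift_map_semiconj (j : 'I_m) (x : L) : f j (Phi x) = g j (f j x).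
Proof. exact: (translator_shift (fun i => h i (f i x))). Qed.

(** Both cancellations come down to the [f i]: these send [Phi x] to
    [g i (f i x)], and they send the candidate preimage of [y] to
    [ginv i (f i y)], so that the corrections added and subtracted agree. *)
Lemma shift_map_inverse (ginv : 'I_m -> F -> F) :
  (forall i, inverse_map (g i) (ginv i)) ->
  inverse_map Phi
    (fun x : L => x - \sum_(i < m) h i (ginv i (f i x)) *: gamma i).
Proof.
move=> gK; split=> [x|y].
  under eq_bigr => i _ do rewrite shift_map_semiconj (proj1 (gK i)).
  by rewrite addrK.
set x := y - _; have fx j : f j x = ginv j (f j y).
  rewrite /x -sumrN; under eq_bigr => i _ do rewrite -scaleNr.
  rewrite (translator_shift (fun i => - h i (ginv i (f i y)))).
  rewrite additive_perm_polyN // mulrN.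
  by rewrite -{1}(proj2 (gK j) (f j y)) addrK.
by rewrite /Phi; under eq_bigr => i _ do rewrite fx; rewrite subrK.
Qed.

Lemma component_bijective (j : 'I_m) : bijective Phi -> bijective (g j).
Proof.
case=> Psi _ PsiK; apply: finType_surj_bij => c.
have [bj0|bj0] := eqVneq (b j) 0.
  by exists c; rewrite /g bj0 mul0r addr0.
have [y <-] := translator_surj (A_perm j) (translator_diag j) bj0 c.
by exists (f j (Psi y)); rewrite -shift_map_semiconj PsiK.
Qed.

End SeveralTranslators.

Theorem theorem3p3 (q n m : nat) (n_gt0 : (0 < n)%N) (m_gt0 : (0 < m)%N)
    (F : finFieldType) (L : fieldExtType F)
    (cardF : #|F| = q) (dimL : \dim {:L} = n)
    (f : 'I_m -> L -> F) (h : 'I_m -> F -> F) (A : 'I_m -> {poly F})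
    (b : 'I_m -> F) (gamma : 'I_m -> L)
    (A_perm : forall i, additive_perm_poly (A i))
    (gamma_neq0 : forall i, gamma i != 0)
    (gamma_free : free [tuple gamma i | i < m])
    (translator_diag : forall i, linear_translator (b i) (A i) (f i) (gamma i))
    (translator_off : forall i j, j != i ->
       linear_translator 0 (A j) (f j) (gamma i)) :
  let Phi := fun x : L => x + \sum_(i < m) h i (f i x) *: gamma i in
  let g := fun (i : 'I_m) (x : F) => x + b i * (A i).[h i x] in
  (bijective Phi <-> forall i, bijective (g i)) /\
  (bijective Phi ->
   forall ginv : 'I_m -> F -> F,
     (forall i, inverse_map (g i) (ginv i)) ->
     inverse_map Phi
       (fun x : L => x - \sum_(i < m) h i (ginv i (f i x)) *: gamma i)).
Proof.
move=> Phi g; split; last first.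
  by move=> _ ginv; apply: (shift_map_inverse A_perm).
split=> [Phi_bij j|g_bij]; first exact: component_bijective Phi_bij.
have gV i : exists ginv : F -> F, inverse_map (g i) ginv.
  by have [ginv gK ginvK] := g_bij i; exists ginv.
have [ginv ginvP] := fin_all_exists gV.
have [PhiK PsiK] :=
  shift_map_inverse A_perm translator_diag translator_off (h := h) ginvP.
by exists (fun x : L => x - \sum_(i < m) h i (ginv i (f i x)) *: gamma i).
Qed.
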